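(* Let $n_x,n_y,n_w$ be positive integers, $f:[n_x]\times[n_y]\to\{0,1\}$, $t(x,y)\ge0$ with $\sum_{x,y}t(x,y)=1$, and for each $w\in[n_w]$ let $p(\cdot|w)$ be a probability distribution on $[n_x]$; these data define an oblivious communication task with figure of merit $S=\sum_{x,y}t(x,y)\,p(z=f(x,y)|x,y)$ and optimal classical value $S^{(2)}_c$. Then the classical bound is also a bound for all preparation noncontextual models: if an operational theory admits a preparation noncontextual ontological model, then for any preparations $P_x$ ($x\in[n_x]$) and any two-outcome measurements $M_y$ ($y\in[n_y]$) of the theory such that the preparations $P_w$ ($w\in[n_w]$), defined as the convex combinations of the $P_x$ with weights $p(x|w)$, are operationally equivalent for all $w\in[n_w]$, the observed probabilities $p(z|x,y)=p(z|M_y,P_x)$ satisfy $$S\le S^{(2)}_c.$$ In other words, any advantage over classical communication in an oblivious communication task implies preparation contextuality.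
   Context: Notation: $[n]=\{1,\dots,n\}$. Classical oblivious communication: an arbitrary positive integer $L$, conditional probabilities $p_e(\tau|x)$, $\tau\in\{1,\dots,L\}$, with $\sum_\tau p_e(\tau|x)=1$, and $p_d(z|y,\tau)$ with $p_d(0|y,\tau)+p_d(1|y,\tau)=1$, such that for each $\tau$ the quantity $\sum_xp(x|w)p_e(\tau|x)$ is the same for all $w\in[n_w]$. Observed probabilities: $p(z|x,y)=\sum_\tau p_e(\tau|x)p_d(z|y,\tau)$. $S^{(2)}_c$ is the supremum of $S$ over all $L$ and all such strategies. Operational theory: a collection of preparations $P$ and a set $\mathcal{M}$ of measurements $M$ with outcome sets $\mathcal{Z}_M$, together with probabilities $p(Z|M,P)$ of outcome $Z\in\mathcal Z_M$ when $M$ is performed on $P$; preparations may be mixed convexly. Two preparations $P,P'$ are operationally equivalent if $p(Z|M,P)=p(Z|M,P')$ for all $M\in\mathcal{M}$ and all $Z\in\mathcal{Z}_M$. Ontological model: a countable ontic state space $\Lambda$, a probability distribution $\mu(\cdot|P)$ on $\Lambda$ for each preparation $P$, and, for each measurement $M$ and $\lambda\in\Lambda$, a probability distribution $\xi(\cdot|M,\lambda)$ on $\mathcal{Z}_M$, such that $p(Z|M,P)=\sum_{\lambda\in\Lambda}\mu(\lambda|P)\,\xi(Z|M,\lambda)$. It is assumed that convex combinations of preparations are represented by the corresponding convex combinations of the distributions $\mu$; in particular $\mu(\lambda|P_w)=\sum_xp(x|w)\mu(\lambda|P_x)$. The ontological model is preparation noncontextual if $\mu(\lambda|P)=\mu(\lambda|P')$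 for all $\lambda\in\Lambda$ whenever $P$ and $P'$ are operationally equivalent. A theory exhibits preparation contextuality if it has no preparation noncontextual ontological model. *)

(* Defs.v *)
From mathcomp Require Import all_boot all_order all_algebra.
From mathcomp Require Import all_classical all_reals ereal esum.
Set Implicit Arguments.
Unset Strict Implicit.
Unset Printing Implicit Defensive.
Import Order.TTheory GRing.Theory Num.Theory.
Local Open Scope classical_set_scope.
Local Open Scope ring_scope.

Record finite_dist (R : realType) (T : finType) := FiniteDist {
  fd_fun :> T -> R ;
  fd_ge0 : forall a, 0 <= fd_fun a ;
  fd_sum1 : \sum_a fd_fun a = 1 }.

Record discrete_dist (R : realType) (T : choiceType) := DiscreteDist {
  dd_fun :> T -> R ;
  dd_ge0 : forall a, 0 <= dd_fun a ;
  dd_sum1 : (\esum_(a in [set: T]) (dd_fun a)%:E = 1)%E }.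

(** [[n]] is ['I_n], and the outcomes 0 and 1 are [false] and [true]. *)
Record oblivious_task (R : realType) (nx ny nw : nat) := ObliviousTask {
  target : 'I_nx -> 'I_ny -> bool ;
  weight : 'I_nx -> 'I_ny -> R ;
  weight_ge0 : forall x y, 0 <= weight x y ;
  weight_sum1 : \sum_x \sum_y weight x y = 1 ;
  obl_dist : 'I_nw -> finite_dist R 'I_nx }.

(** [p z x y] stands for p(z|x,y). *)
Definition merit (R : realType) (nx ny nw : nat)
    (T : oblivious_task R nx ny nw) (p : bool -> 'I_nx -> 'I_ny -> R) : R :=
  \sum_x \sum_y weight T x y * p (target T x y) x y.

Record classical_strategy (R : realType) (nx ny nw : nat)
    (T : oblivious_task R nx ny nw) := ClassicalStrategy {
  cs_size : nat ;
  cs_size_gt0 : (0 < cs_size)%N ;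
  cs_enc : 'I_nx -> finite_dist R 'I_cs_size ;
  cs_dec : 'I_ny -> 'I_cs_size -> finite_dist R bool ;
  cs_oblivious : forall (tau : 'I_cs_size) (w w' : 'I_nw),
    \sum_x obl_dist T w x * cs_enc x tau =
    \sum_x obl_dist T w' x * cs_enc x tau }.

Arguments cs_dec {R nx ny nw T} _ _ _.

Definition classical_prob (R : realType) (nx ny nw : nat)
    (T : oblivious_task R nx ny nw) (s : classical_strategy T)
    (z : bool) (x : 'I_nx) (y : 'I_ny) : R :=
  \sum_(tau < cs_size s) cs_enc s x tau * cs_dec s y tau z.

(** The set is nonempty (take a single message) and bounded above by 1, so the
    real-valued [sup] does not take its default value. *)
Definition classical_value (R : realType) (nx ny nw : nat)
    (T : oblivious_task R nx ny nw) : R :=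
  sup (range (fun s : classical_strategy T => merit T (classical_prob s))).

(** No convexity axioms (such as idempotence) are imposed on [mix]: a mixture
    is a preparation procedure, of which only the statistics are specified. *)
Record operational_theory (R : realType) := OperationalTheory {
  prep : Type ;
  meas : Type ;
  outcome : meas -> choiceType ;
  op_prob : forall M : meas, prep -> discrete_dist R (outcome M) ;
  mix : forall n : nat, finite_dist R 'I_n -> ('I_n -> prep) -> prep ;
  op_prob_mix : forall (n : nat) (q : finite_dist R 'I_n) (P : 'I_n -> prep)
      (M : meas) (Z : outcome M),
    op_prob M (mix q P) Z = \sum_i q i * op_prob M (P i) Z }.

Definition op_equiv (R : realType) (Th : operational_theory R)
    (P P' : prep Th) : Prop :=
  forall (M : meas Th) (Z : outcome M), op_prob M P Z = op_prob M P' Z.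

Record ontological_model (R : realType) (Th : operational_theory R) :=
  OntologicalModel {
  ontic : countType ;
  om_mu : prep Th -> discrete_dist R ontic ;
  om_xi : forall M : meas Th, ontic -> discrete_dist R (outcome M) ;
  om_prob : forall (M : meas Th) (P : prep Th) (Z : outcome M),
    ((op_prob M P Z)%:E =
     \esum_(l in [set: ontic]) (om_mu P l * om_xi M l Z)%:E)%E ;
  om_mix : forall (n : nat) (q : finite_dist R 'I_n) (P : 'I_n -> prep Th)
      (l : ontic),
    om_mu (mix q P) l = \sum_i q i * om_mu (P i) l }.

Definition prep_noncontextual (R : realType) (Th : operational_theory R)
    (m : ontological_model Th) : Prop :=
  forall P P' : prep Th, op_equiv P P' ->
    forall l : ontic m, om_mu m P l = om_mu m P' l.

Definition admits_prep_noncontextual (R : realType)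
    (Th : operational_theory R) : Prop :=
  exists m : ontological_model Th, prep_noncontextual m.

Definition prep_contextual (R : realType) (Th : operational_theory R) : Prop :=
  ~ admits_prep_noncontextual Th.

(** A two-outcome measurement is one whose outcome set is in bijection with
    {0,1}; [out y] is the labelling of the outcomes of [M y]. *)
Definition observed_prob (R : realType) (Th : operational_theory R)
    (nx ny : nat) (P : 'I_nx -> prep Th) (M : 'I_ny -> meas Th)
    (out : forall y, bool -> outcome (M y))
    (z : bool) (x : 'I_nx) (y : 'I_ny) : R :=
  op_prob (M y) (P x) (out y z).

(* Main.v *)
Require Import Defs.
From mathcomp Require Import all_boot all_order all_algebra.
From mathcomp Require Import all_classical all_reals ereal esum.
Set Implicit Arguments.
Unset Strict Implicit.
Unset Printing Implicit Defensive.
Import Order.TTheory GRing.Theory Num.Theory.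
Local Open Scope classical_set_scope.
Local Open Scope ring_scope.

(** Noncontextuality makes the ontic state an oblivious classical message: the
    distributions [mu(.|P_w)] coincide, so sending the ontic state and decoding
    with the response functions [xi] is an oblivious strategy reproducing the
    observed probabilities. Since a message alphabet must be finite, only the
    ontic states of a finite set are sent, all the others being merged into one
    additional message. The merit of this truncated strategy dominates the
    corresponding finite partial sum of [S], and [S] is the supremum of its
    finite partial sums. *)

Lemma finite_dist_le1 (R : realType) (I : finType) (q : finite_dist R I) (a : I) :
  q a <= 1.
Proof.
rewrite -(fd_sum1 q) (bigD1 a) //= lerDl; apply: sumr_ge0 => i _.
exact: fd_ge0.
Qed.

Lemma sum_discrete_dist_le1 (R : realType) (L : choiceType)
    (q : discrete_dist R L) (s : seq L) :
  uniq s -> \sum_(l <- s) q l <= 1.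
Proof.
move=> us; rewrite -lee_fin -sumEFin -(dd_sum1 q) fsbig_seq //.
by apply: esum_ge; exists [set` s] => //; split=> //; exact: finite_seq.
Qed.

(** An [esum] is a supremum of finite sums, and scaling by a nonnegative real commutes with suprema
    of nonempty sets. *)
Lemma esumZl (R : realType) (L : choiceType) (D : set L) (r : R)
    (f : L -> \bar R) :
  0 <= r -> (forall l, 0 <= f l)%E ->
  (\esum_(l in D) (r%:E * f l) = r%:E * \esum_(l in D) f l)%E.
Proof.
move=> r_ge0 f_ge0; rewrite /esum -ereal_supZl //; last first.
  (* Nonempty: the empty subset contributes the sum 0. *)
  by apply/set0P; exists 0%E, set0; [exact: fsets_set0 | rewrite fsbig_set0].
rewrite image_comp; congr ereal_sup; apply: eq_imagel => A _ /=.
by rewrite ge0_mule_fsumr.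
Qed.

(** The total mass reindexes along the bijection, and over a finite type [esum] is an ordinary sum.
    This makes response functions usable as decoders. *)
Lemma sum_esum_labelling (R : realType) (I : finType) (Z : choiceType)
    (out : I -> Z) (q : discrete_dist R Z) :
  bijective out -> \sum_i q (out i) = 1.
Proof.
move=> out_bij; apply: EFin_inj.
rewrite -sumEFin -(dd_sum1 q) (reindex_esum [set: I] [set: Z] out); last first.
  by rewrite setTT_bijective.
rewrite esum_fset; [|exact: finite_finset|by move=> i _; rewrite lee_fin dd_ge0].
rewrite fsbig_seq ?index_enum_uniq //; congr (\sum_(i \in _) _)%E.
by apply/seteqP; split=> i //= _; exact: mem_index_enum.
Qed.

Definition relabel_dist (R : realType) (I : finType) (Z : choiceType)
    (out : I -> Z) (out_bij : bijective out) (q : discrete_dist R Z) :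
    finite_dist R I :=
  FiniteDist (fun i => dd_ge0 q (out i)) (sum_esum_labelling q out_bij).

Lemma point_dist_ge0 (R : realType) (I : finType) (a i : I) :
  0 <= (i == a)%:R :> R.
Proof. by rewrite ler0n. Qed.

Lemma point_dist_sum1 (R : realType) (I : finType) (a : I) :
  \sum_i (i == a)%:R = 1 :> R.
Proof.
by rewrite (bigD1 a) //= eqxx big1 ?addr0 // => i /negbTE ->.
Qed.

Definition point_dist (R : realType) (I : finType) (a : I) : finite_dist R I :=
  FiniteDist (point_dist_ge0 R a) (point_dist_sum1 R a).

(** Message [ord0] stands for all the ontic states outside [s]. *)
Definition truncate (R : realType) (L : choiceType) (s : seq L)
    (q : L -> R) (tau : 'I_(size s).+1) : R :=
  oapp (fun i => q (tnth (in_tuple s) i)) (1 - \sum_(l <- s) q l)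
    (unlift ord0 tau).

Lemma truncate_ge0 (R : realType) (L : choiceType) (s : seq L) (us : uniq s)
    (q : discrete_dist R L) (tau : 'I_(size s).+1) :
  0 <= truncate q tau.
Proof.
rewrite /truncate; case: unliftP => [i _|_] /=; first exact: dd_ge0.
by rewrite subr_ge0 sum_discrete_dist_le1.
Qed.

Lemma truncate_sum1 (R : realType) (L : choiceType) (s : seq L) (q : L -> R) :
  \sum_(tau < (size s).+1) truncate q tau = 1.
Proof.
rewrite big_ord_recl /truncate unlift_none /= big_tnth.
by under eq_bigr do rewrite liftK; rewrite /= subrK.
Qed.

(** The entry at [ord0] is affine in [q], not linear, so it commutes with mixing because the weights
    sum to 1. *)
Lemma truncate_mix (R : realType) (L : choiceType) (s : seq L) (I : finType)
    (w : finite_dist R I) (q : I -> L -> R) (tau : 'I_(size s).+1) :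
  \sum_i w i * truncate (q i) tau =
  truncate (fun l => \sum_i w i * q i l) tau.
Proof.
rewrite /truncate; case: unliftP => [i _|_] //=.
rewrite exchange_big /= -[X in _ = X - _](fd_sum1 w) -sumrB; apply: eq_bigr => i _.
by rewrite mulrBr mulr1 mulr_sumr.
Qed.

Definition truncate_dist (R : realType) (L : choiceType) (s : seq L)
    (us : uniq s) (q : discrete_dist R L) : finite_dist R 'I_(size s).+1 :=
  FiniteDist (truncate_ge0 us q) (truncate_sum1 s q).

(** Provides the upper bound that makes [sup] in [classical_value] a genuine supremum. *)
Lemma merit_classical_le1 (R : realType) (nx ny nw : nat)
    (T : oblivious_task R nx ny nw) (s : classical_strategy T) :
  merit T (classical_prob s) <= 1.
Proof.
rewrite -(weight_sum1 T); apply: ler_sum => x _; apply: ler_sum => y _.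
apply: ler_piMr; first exact: weight_ge0.
rewrite -(fd_sum1 (cs_enc s x)); apply: ler_sum => tau _.
by apply: ler_piMr; [exact: fd_ge0 | exact: finite_dist_le1].
Qed.

Lemma merit_classical_le_value (R : realType) (nx ny nw : nat)
    (T : oblivious_task R nx ny nw) (s : classical_strategy T) :
  merit T (classical_prob s) <= classical_value T.
Proof.
apply: ub_le_sup; last by exists s.
by exists 1 => _ [s' _ <-]; exact: merit_classical_le1.
Qed.

Lemma truncated_merit_le (R : realType) (nx ny nw : nat)
    (T : oblivious_task R nx ny nw) (L : choiceType)
    (mu : 'I_nx -> discrete_dist R L) (xi : 'I_ny -> L -> finite_dist R bool)
    (s : seq L) :
  (forall w w' l, \sum_x obl_dist T w x * mu x l =
                  \sum_x obl_dist T w' x * mu x l) ->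
  uniq s ->
  merit T (fun z x y => \sum_(l <- s) mu x l * xi y l z) <= classical_value T.
Proof.
move=> mu_obl us.
(* The answer to the merged message [ord0] is an arbitrary choice. *)
pose dec y (tau : 'I_(size s).+1) :=
  oapp (fun i => xi y (tnth (in_tuple s) i)) (point_dist R false)
    (unlift ord0 tau).
have enc_obl (tau : 'I_(size s).+1) (w w' : 'I_nw) :
    \sum_x obl_dist T w x * truncate_dist us (mu x) tau =
    \sum_x obl_dist T w' x * truncate_dist us (mu x) tau.
  (* Mixing before truncating leaves only the mixtures of the [mu x], which do not depend on [w]. *)
  rewrite /= !truncate_mix; congr (truncate _ tau).
  by apply: funext => l; exact: mu_obl.
pose S := ClassicalStrategy (ltn0Sn _) dec enc_obl.
apply: le_trans (merit_classical_le_value S).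
apply: ler_sum => x _; apply: ler_sum => y _.
apply: ler_wpM2l; first exact: weight_ge0.
rewrite /classical_prob /= big_ord_recl big_tnth.
under [in leRHS]eq_bigr do rewrite /dec /truncate liftK /=.
(* Only the nonnegative term of [ord0] separates the two sides. *)
by rewrite lerDr mulr_ge0 ?truncate_ge0 ?fd_ge0.
Qed.

Lemma merit_le_classical_value (R : realType) (nx ny nw : nat)
    (T : oblivious_task R nx ny nw) (L : choiceType)
    (mu : 'I_nx -> discrete_dist R L) (xi : 'I_ny -> L -> finite_dist R bool)
    (p : bool -> 'I_nx -> 'I_ny -> R) :
  (forall w w' l, \sum_x obl_dist T w x * mu x l =
                  \sum_x obl_dist T w' x * mu x l) ->
  (forall z x y,
    ((p z x y)%:E = \esum_(l in [set: L]) (mu x l * xi y l z)%:E)%E) ->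
  merit T p <= classical_value T.
Proof.
move=> mu_obl pE.
(* The contribution of the single ontic state [l] to the merit. *)
pose g l := merit T (fun z x y => mu x l * xi y l z).
have g_ge0 x y l : 0 <= weight T x y * (mu x l * xi y l (target T x y)).
  by rewrite !mulr_ge0 ?weight_ge0 ?dd_ge0 ?fd_ge0.
have meritE : ((merit T p)%:E = \esum_(l in [set: L]) (g l)%:E)%E.
  rewrite (eq_esum (b := fun l => \sum_x \sum_y
      (weight T x y * (mu x l * xi y l (target T x y)))%:E)%E); last first.
    by move=> l _; rewrite /g /merit -sumEFin; apply: eq_bigr => x _; rewrite sumEFin.
  (* Nonnegativity of the terms lets [esum] pass through the finite sums over [x] and [y]. *)
  rewrite esum_sum; last by move=> l x _ _; apply: sume_ge0 => y _; rewrite lee_fin.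
  rewrite /merit -sumEFin; apply: eq_bigr => x _.
  rewrite esum_sum; last by move=> l y _ _; rewrite lee_fin.
  rewrite -sumEFin; apply: eq_bigr => y _.
  rewrite EFinM pE -esumZl ?weight_ge0 //.
  by move=> l; rewrite lee_fin mulr_ge0 ?dd_ge0 ?fd_ge0.
(* It suffices to bound each finite partial sum, whose index set [A] serves as the list of ontic
   states sent. *)
rewrite -lee_fin meritE; apply: ge_ereal_sup => _ [A [finA _] <-].
rewrite fsbig_finite // sumEFin lee_fin.
apply: le_trans (truncated_merit_le xi mu_obl (finmap.fset_uniq (fset_set A))).
rewrite /g /merit exchange_big le_eqVlt; apply/predU1P; left.
apply: eq_bigr => x _; rewrite exchange_big; apply: eq_bigr => y _.
by rewrite mulr_sumr.
Qed.

Lemma noncontextual_merit_le (R : realType) (nx ny nw : nat)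
    (T : oblivious_task R nx ny nw) (Th : operational_theory R)
    (P : 'I_nx -> prep Th) (M : 'I_ny -> meas Th)
    (out : forall y, bool -> outcome (M y)) :
  admits_prep_noncontextual Th ->
  (forall y, bijective (out y)) ->
  (forall w w' : 'I_nw,
    op_equiv (mix (obl_dist T w) P) (mix (obl_dist T w') P)) ->
  merit T (observed_prob P out) <= classical_value T.
Proof.
move=> [m noncontextual_m] out_bij equivP.
apply: (@merit_le_classical_value _ _ _ _ T _ (fun x => om_mu m (P x))
  (fun y l => relabel_dist (out_bij y) (om_xi (M y) l))).
  (* By [om_mix] both sides are values of [om_mu] at mixed preparations, which are operationally
     equivalent. *)
  by move=> w w' l; rewrite -!om_mix; exact: noncontextual_m.
by move=> z x y; exact: om_prob.
Qed.

Theorem mainTheorem6 (R : realType) (nx ny nw : nat)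
    (nx_gt0 : (0 < nx)%N) (ny_gt0 : (0 < ny)%N) (nw_gt0 : (0 < nw)%N)
    (T : oblivious_task R nx ny nw) (Th : operational_theory R) :
  (admits_prep_noncontextual Th ->
    forall (P : 'I_nx -> prep Th) (M : 'I_ny -> meas Th)
      (out : forall y, bool -> outcome (M y)),
    (forall y, bijective (out y)) ->
    (forall w w' : 'I_nw,
      op_equiv (mix (obl_dist T w) P) (mix (obl_dist T w') P)) ->
    merit T (observed_prob P out) <= classical_value T)
  /\
  (forall (P : 'I_nx -> prep Th) (M : 'I_ny -> meas Th)
      (out : forall y, bool -> outcome (M y)),
    (forall y, bijective (out y)) ->
    (forall w w' : 'I_nw,
      op_equiv (mix (obl_dist T w) P) (mix (obl_dist T w') P)) ->
    classical_value T < merit T (observed_prob P out) ->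
    prep_contextual Th).
Proof.
split; first by move=> ? P M out; exact: noncontextual_merit_le.
move=> P M out out_bij equivP; rewrite ltNge => /negP gt_value ncTh.
exact/gt_value/noncontextual_merit_le.
Qed.
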